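(* Consider the adaptive circuit $\mathcal{E}=\mathcal{U}_T\circ\mathcal{A}_T\circ\cdots\circ\mathcal{U}_1\circ\mathcal{A}_1\circ\mathcal{U}_0$, a Gaussian initial state $|\phi_0\rangle$, a positive integer $k$, and the random sparsification procedure, all as described in the context. The procedure, which has runtime $O(kT)$, returns a description of a sparsified operator $\Omega=\sum_{\vec m}|\Omega_{\vec m}\rangle\langle\Omega_{\vec m}|$ with probability $\Pr(\Omega)$, where each $|\Omega_{\vec m}\rangle$ is a non-normalized superposition over $k$ terms, such that the expected normalized state defined by $$\rho_1=\mathbb{E}\left(\frac{\Omega}{\operatorname{Tr}[\Omega]}\right)=\sum_{\Omega}\Pr(\Omega)\frac{\Omega}{\operatorname{Tr}[\Omega]}$$ satisfies $$\left\|\rho_1-\mathcal{E}(|\phi_0\rangle\langle\phi_0|)\right\|_1\le 2\,\frac{\|c\|_1^2}{k}+\sqrt{\operatorname{Var}(\operatorname{Tr}[\Omega])},$$ where $\|c\|_1=\sum_{\vec v}|c_{\vec v}|$.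
   Context: Gaussian objects. On $n$ qubits let $c_{2j-1}=Z^{\otimes(j-1)}\otimes X\otimes I^{\otimes(n-j)}$ and $c_{2j}=Z^{\otimes(j-1)}\otimes Y\otimes I^{\otimes(n-j)}$, $j=1,\dots,n$. A unitary $U$ is Gaussian if there is $R\in O(2n)$ with $Uc_jU^\dagger=\sum_{k}R_{j,k}c_k$ for all $j$. A pure state is Gaussian if it equals $U|0\rangle^{\otimes n}$ with $U$ Gaussian. Circuit. $\mathcal{U}_t(\cdot)=U_t(\cdot)U_t^\dagger$ for $t=0,\dots,T$, where the (in general non-Gaussian) $n$-qubit unitary $U_t$ has a known decomposition $U_t=\sum_v\alpha_{t,v}V_{t,v}$ with $\alpha_{t,v}\in\mathbb{C}$ and Gaussian unitaries $V_{t,v}$; $\|\alpha_t\|_1=\sum_v|\alpha_{t,v}|$. For $t=1,\dots,T$, $\mathcal{A}_t(\cdot)=\sum_{m\in\{0,1\}}K_{t,m}(\cdot)K_{t,m}^\dagger$ is a CPTP adaptive channel whose Kraus operators $K_{t,0},K_{t,1}$ are free operators, i.e. they map Gaussian states to (possibly subnormalized) Gaussian states (for example a projector onto computational basis states composed with a Gaussian unitary). For a pattern $\vec v=(v_0,\dots,v_T)$ let $c_{\vec v}=\prod_{t=0}^T\alpha_{t,v_t}$, so that $\|c\|_1=\prod_{t=0}^T\|\alpha_t\|_1$. The vectors $\vec m=(m_1,\dots,m_T)$ range over $\{0,1\}^T$. Sparsification procedure. (1) For each $i=1,\dots,k$, independently: for each $t=0,\dots,T$, sample an index $v$ with probability $|\alpha_{t,v}|/\|\alpha_t\|_1$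 and set $W_{i,t}=(\alpha_{t,v}/|\alpha_{t,v}|)V_{t,v}$; then let $S_{i,\vec m}=W_{i,T}K_{T,m_T}\cdots W_{i,1}K_{1,m_1}W_{i,0}$ (the same sampled gates are used for all $\vec m$). (2) Let $S_{\vec m}=\frac{\|c\|_1}{k}\sum_{i=1}^kS_{i,\vec m}$. (3) Let $|\Omega_{\vec m}\rangle=S_{\vec m}|\phi_0\rangle$ and $\Omega=\sum_{\vec m}S_{\vec m}|\phi_0\rangle\langle\phi_0|S_{\vec m}^\dagger=\sum_{\vec m}|\Omega_{\vec m}\rangle\langle\Omega_{\vec m}|$. The description that is returned consists of the sampled Gaussian gates and the phase for each of the $k$ terms (the sum over $\vec m$ is not stored explicitly). Expectation and variance are over the random choices. $\|\cdot\|_1$ of an operator is the trace norm. *)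

(* Defs.v *)
From HB Require Import structures.
From mathcomp Require Import all_boot all_order all_algebra.
From mathcomp Require Import sesquilinear spectral reals complex mxtens.

Set Implicit Arguments.
Unset Strict Implicit.
Unset Printing Implicit Defensive.

Import Order.TTheory GRing.Theory Num.Theory.
Local Open Scope ring_scope.
Local Open Scope sesquilinear_scope.
Local Open Scope complex_scope.

Section TraceNorm.
Variables (C : numClosedFieldType) (d : nat).
Implicit Types A : 'M[C]_d.

(* Meaningful for positive semidefinite A only. *)
Definition sqrtmx A : 'M[C]_d :=
  invmx (spectralmx A) *m diag_mx (map_mx sqrtC (spectral_diag A))
    *m spectralmx A.

Definition trace_norm A : C := \tr (sqrtmx (A ^t* *m A)).

(* Since 0^-1 = 0, a positive semidefinite A with zero trace (i.e. A = 0) is sent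
   to 0. *)
Definition normalized A : 'M[C]_d := (\tr A)^-1 *: A.

End TraceNorm.

Section Gaussian.
Variable R : realType.
Local Notation C := R[i].

Definition pauliX : 'M[C]_2 := \matrix_(i, j) (i != j)%:R.
Definition pauliY : 'M[C]_2 :=
  \matrix_(i, j) (if i == j then 0 else if i == 0 then - 'i%C else 'i%C).
Definition pauliZ : 'M[C]_2 :=
  \matrix_(i, j) (if i == j then (-1) ^+ i else 0).

Lemma half_ord_subproof n (l : 'I_(n.*2)) : (l./2 < n)%N.
Proof. by rewrite ltn_half_double. Qed.

Lemma site_dim n (j : 'I_n) : (2 ^ j * 2 * 2 ^ (n - j.+1) = 2 ^ n)%N.
Proof. by rewrite -expnSr -expnD subnKC. Qed.

(* Z (x) .. (x) Z (x) P (x) I (x) .. (x) I with P at the 0-based site j. *)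
Definition jordan_wigner n (j : 'I_n) (P : 'M[C]_2) : 'M[C]_(2 ^ n) :=
  castmx (site_dim j, site_dim j) (ntensmx pauliZ j *t P *t 1%:M).

(* 0-based: the indices 2j and 2j+1 carry X and Y at site j. *)
Definition majorana n (l : 'I_(n.*2)) : 'M[C]_(2 ^ n) :=
  jordan_wigner (Ordinal (half_ord_subproof l))
    (if odd l then pauliY else pauliX).

Definition gaussian_unitary n (U : 'M[C]_(2 ^ n)) : Prop :=
  U \is unitarymx /\
  exists2 Q : 'M[R]_(n.*2), Q *m Q^T = 1%:M &
    forall j, U *m majorana j *m U ^t* = \sum_l (Q j l)%:C *: majorana l.

Definition ket0 n : 'cV[C]_(2 ^ n) :=
  castmx (erefl, exp1n n) (ntensmx (delta_mx 0 0 : 'cV[C]_2) n).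

Definition gaussian_state n (phi : 'cV[C]_(2 ^ n)) : Prop :=
  exists2 U, gaussian_unitary U & phi = U *m ket0 n.

Definition free_operator n (K : 'M[C]_(2 ^ n)) : Prop :=
  forall phi, gaussian_state phi ->
    exists s g, [/\ `|s| <= 1, gaussian_state g & K *m phi = s *: g].

Definition gaussian_superposition n k (psi : 'cV[C]_(2 ^ n)) : Prop :=
  exists (b : 'I_k -> C) (g : 'I_k -> 'cV[C]_(2 ^ n)),
    (forall i, gaussian_state (g i)) /\ psi = \sum_i b i *: g i.

Definition adjoint_action n (M rho : 'M[C]_(2 ^ n)) : 'M[C]_(2 ^ n) :=
  M *m rho *m M ^t*.

Definition ketbra n (phi : 'cV[C]_(2 ^ n)) : 'M[C]_(2 ^ n) := phi *m phi ^t*.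

Definition kraus_map n (K : bool -> 'M[C]_(2 ^ n)) (rho : 'M[C]_(2 ^ n)) :
  'M[C]_(2 ^ n) := \sum_m adjoint_action (K m) rho.

End Gaussian.

(* A channel indexed by t : 'I_T precedes the gate indexed by lift ord0 t,
   which has value t.+1. Only trace preservation is required of the channels:
   complete positivity is automatic for a map in Kraus form. *)
Record circuit (R : realType) (n T : nat) := Circuit {
  gate : 'I_T.+1 -> 'M[R[i]]_(2 ^ n);
  nterms : 'I_T.+1 -> nat;
  coef : forall t, 'I_(nterms t) -> R[i];
  term : forall t, 'I_(nterms t) -> 'M[R[i]]_(2 ^ n);
  kraus : 'I_T -> bool -> 'M[R[i]]_(2 ^ n);
  gate_unitary : forall t, gate t \is unitarymx;
  term_gaussian : forall t v, gaussian_unitary (@term t v);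
  gate_decomposition : forall t, gate t = \sum_v @coef t v *: @term t v;
  kraus_trace_preserving :
    forall t rho, \tr (kraus_map (kraus t) rho) = \tr rho;
  kraus_free : forall t m, free_operator (kraus t m)
}.

(* Randomized programs over unit-cost primitives: drawing an index v with
   probability |a v| / sum_u |a u|, and a deterministic elementary step (one
   scalar operation, or recording one item). *)
Inductive prog (R : realType) (A : Type) : Type :=
| Ret of A
| Step of prog R A
| Sample N of ('I_N -> R[i]) & ('I_N -> prog R A).
Arguments Ret {R A}.
Arguments Step {R A}.
Arguments Sample {R A N}.

Section Programs.
Variable R : realType.
Local Notation C := R[i].
Local Notation prog := (prog R).

Fixpoint bind A B (p : prog A) (f : A -> prog B) : prog B :=
  match p with
  | Ret x => f x
  | Step q => Step (bind q f)
  | Sample _ a q => Sample a (fun v => bind (q v) f)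
  end.

Fixpoint for_each I A (s : seq I) (body : I -> prog A) : prog (seq A) :=
  if s is i :: s' then
    bind (body i) (fun x => bind (for_each s' body) (fun xs =>
      Step (Ret (x :: xs))))
  else Ret [::].

(* Worst case over the random choices. *)
Fixpoint runtime A (p : prog A) : nat :=
  match p with
  | Ret _ => 0
  | Step q => (runtime q).+1
  | Sample _ _ q => (\max_v runtime (q v)).+1
  end.

Fixpoint outcomes A (p : prog A) : seq (C * A) :=
  match p with
  | Ret x => [:: (1, x)]
  | Step q => outcomes q
  | Sample N a q =>
      flatten [seq [seq (`|a v| / (\sum_u `|a u|) * o.1, o.2)
                   | o <- outcomes (q v)] | v <- enum 'I_N]
  end.

Definition results A (p : prog A) : seq A := [seq o.2 | o <- outcomes p].

Definition prob A (p : prog A) (P : pred A) : C :=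
  \sum_(o <- outcomes p | P o.2) o.1.

Definition expectation A (V : lmodType C) (p : prog A) (f : A -> V) : V :=
  \sum_(o <- outcomes p) o.1 *: f o.2.

Definition variance A (p : prog A) (X : A -> C) : C :=
  let mean := expectation p (X : A -> C^o) in
  expectation p (fun x => `|X x - mean| ^+ 2 : C^o).

End Programs.

Section Sparsification.
Variables (R : realType) (n T : nat) (E : circuit R n T).
Local Notation C := R[i].

Definition circuit_channel (rho : 'M[C]_(2 ^ n)) : 'M[C]_(2 ^ n) :=
  foldl (fun sigma (t : 'I_T) =>
           adjoint_action (gate E (lift ord0 t)) (kraus_map (kraus E t) sigma))
        (adjoint_action (gate E ord0) rho) (enum 'I_T).

Definition pattern := {dffun forall t : 'I_T.+1, 'I_(nterms E t)}.

Definition pattern_coef (v : pattern) : C := \prod_t coef (v t).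

Definition coef_norm1 : C := \sum_(v : pattern) `|pattern_coef v|.

(* (phase, gate) pairs for t = 0, .., T; one such list for each of the terms. *)
Definition term_description := seq (C * 'M[C]_(2 ^ n)).
Definition description := seq term_description.

(* For coef v = 0, of probability 0, the phase evaluates to 0. *)
Definition sample_gate (t : 'I_T.+1) : prog R (C * 'M[C]_(2 ^ n)) :=
  Sample (@coef _ _ _ E t) (fun v =>
    Step (Ret (coef v / `|coef v|, term v))).

Definition sparsify (k : nat) : prog R description :=
  for_each (iota 0 k) (fun=> for_each (enum 'I_T.+1) sample_gate).

Definition sampled_gate (w : term_description) (t : nat) : 'M[C]_(2 ^ n) :=
  let: (z, V) := nth (0, 0) w t in z *: V.

Definition term_operator (w : term_description) (m : {ffun 'I_T -> bool}) :
  'M[C]_(2 ^ n) :=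
  foldl (fun S (t : 'I_T) => sampled_gate w t.+1 *m kraus E t (m t) *m S)
        (sampled_gate w 0) (enum 'I_T).

Definition sparse_operator (d : description) (m : {ffun 'I_T -> bool}) :
  'M[C]_(2 ^ n) :=
  (coef_norm1 / (size d)%:R) *: \sum_(w <- d) term_operator w m.

Definition omega_ket (phi0 : 'cV[C]_(2 ^ n)) (d : description)
    (m : {ffun 'I_T -> bool}) : 'cV[C]_(2 ^ n) :=
  sparse_operator d m *m phi0.

Definition omega (phi0 : 'cV[C]_(2 ^ n)) (d : description) : 'M[C]_(2 ^ n) :=
  \sum_m adjoint_action (sparse_operator d m) (ketbra phi0).

End Sparsification.

(* Main.v *)
(* The operator Omega is a mean of independent copies, so E[Omega] differs from
   sigma = E(|phi0><phi0|) only through its diagonal terms: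
   E[Omega] - sigma = (G - sigma)/k, where G is the second moment of one sample
   and q = Tr G satisfies 1 <= q <= |c|_1^2.  Both G and sigma are sums of
   positive rank-one operators, so this difference has trace norm at most
   (q + 1)/k.  Normalizing costs at most E|1 - Tr Omega|
   <= |1 - E Tr Omega| + sqrt Var = (q - 1)/k + sqrt Var, and the two errors add
   up to 2q/k + sqrt Var.  Instead of the triangle inequality for the trace norm
   we use |A|_1 = Tr(W A) for a contraction W coming from the polar
   decomposition, together with |<x, W x>| <= |x|^2. *)
Require Import Defs.
From mathcomp Require Import all_boot all_order all_algebra.
From mathcomp Require Import sesquilinear spectral reals complex mxtens.
From mathcomp Require Import zify ring.
Set Implicit Arguments.
Unset Strict Implicit.
Unset Printing Implicit Defensive.
Import Order.TTheory GRing.Theory Num.Theory.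
Local Open Scope ring_scope.
Local Open Scope sesquilinear_scope.

(** * Duality for the trace norm *)

Section TraceNormDuality.
Variable C : numClosedFieldType.

Lemma adjmxM m n p (A : 'M[C]_(m, n)) (B : 'M_(n, p)) :
  (A *m B)^t* = B^t* *m A^t*.
Proof. by rewrite trmx_mul map_mxM. Qed.

Lemma adjmxD m n (A B : 'M[C]_(m, n)) : (A + B)^t* = A^t* + B^t*.
Proof. by rewrite linearD map_mxD. Qed.

Lemma adjmxZ m n a (A : 'M[C]_(m, n)) : (a *: A)^t* = a^* *: A^t*.
Proof. by rewrite linearZ map_mxZ. Qed.

Lemma mxtrace_mul_adjmx m n (A : 'M[C]_(m, n)) :
  \tr (A *m A^t*) = \sum_i \sum_j `|A i j| ^+ 2.
Proof.
apply: eq_bigr => i _; rewrite mxE; apply: eq_bigr => j _.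
by rewrite !mxE normCK.
Qed.

Lemma mxtrace_mul_adjmx_ge0 m n (A : 'M[C]_(m, n)) : 0 <= \tr (A *m A^t*).
Proof.
rewrite mxtrace_mul_adjmx; apply: sumr_ge0 => i _; apply: sumr_ge0 => j _.
exact: exprn_ge0.
Qed.

Lemma mxtrace_unitary_conj n (U A : 'M[C]_n) :
  U \is unitarymx -> \tr (U *m A *m U^t*) = \tr A.
Proof.
move=> Uu; rewrite mxtrace_mulC mulmxA -(invmx_unitary Uu).
by rewrite mulVmx ?mul1mx ?unitarymx_unit.
Qed.

Lemma mxtrace_adjmx_gram m n (A : 'M[C]_(m, n)) (x : 'cV_n) :
  \tr (A *m x *m (A *m x)^t*) = \tr (A^t* *m A *m (x *m x^t*)).
Proof. by rewrite adjmxM mulmxA mxtrace_mulC !mulmxA. Qed.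

(** Entrywise [2ab <= a^2 + b^2]. This weak form of Cauchy-Schwarz suffices because it is applied to
    a [y] that is no longer than [x]. *)
Lemma le_mxtrace_mul_adjmx n (x y : 'cV[C]_n) :
  `|\tr (x *m y^t*)| <= (\tr (x *m x^t*) + \tr (y *m y^t*)) / 2.
Proof.
rewrite !mxtrace_mul_adjmx -big_split /= mulr_suml.
apply: le_trans (ler_norm_sum _ _ _) _; apply: ler_sum => i _.
rewrite mxE !big_ord1 !mxE normrM norm_conjC ler_pdivlMr ?ltr0n //.
rewrite -subr_ge0.
have -> : `|x i 0| ^+ 2 + `|y i 0| ^+ 2 - `|x i 0| * `|y i 0| * 2
   = (`|x i 0| - `|y i 0|) ^+ 2 by ring.
by rewrite real_exprn_even_ge0 // realB ?normr_real.
Qed.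

Section Duality.
Variables (d : nat) (D : 'M[C]_d).
Let H := D^t* *m D.
Let Q := spectralmx H.
Let s := spectral_diag H.
Let r := \row_i (sqrtC (s 0 i))^-1.

Lemma gram_spectral : H = Q^t* *m diag_mx s *m Q.
Proof.
have Hn : H \is normalmx.
  by apply/normalmxP; rewrite /H adjmxM trmxCK.
by rewrite -(invmx_unitary (spectral_unitarymx H)); apply/orthomx_spectralP.
Qed.

(** The eigenvalues of [D^* D] form the Gram matrix of the columns of [D Q^*]. This shows that they
    are nonnegative and lets the length of [D Q^* z] be computed coordinatewise. *)
Lemma gram_spectral_diag : diag_mx s = (D *m Q^t*)^t* *m (D *m Q^t*).
Proof.
have Qu := spectral_unitarymx H.
rewrite adjmxM trmxCK -mulmxA (mulmxA _ D) -/H [in RHS]gram_spectral.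
rewrite !mulmxA mulmxtVK // (unitarymxP _) // mul1mx //.
Qed.

Lemma gram_spectral_diag_ge0 i : 0 <= s 0 i.
Proof.
have := congr1 (fun A : 'M_d => A i i) gram_spectral_diag.
rewrite mxE eqxx mulr1n => ->; rewrite mxE; apply: sumr_ge0 => j _.
by rewrite !mxE -normCKC exprn_ge0.
Qed.

(* [dual_witness] is the adjoint of the partial isometry in the polar
   decomposition of [D]; zero eigenvalues of [D^* D] are killed because
   0^-1 = 0. *)
Let dual_witness := Q^t* *m diag_mx r *m Q *m D^t*.

Lemma mxtrace_dual_witness : trace_norm D = \tr (dual_witness *m D).
Proof.
have Qu := spectral_unitarymx H.
have -> : dual_witness *m D = Q^t* *m (diag_mx r *m diag_mx s) *m Q.
  rewrite /dual_witness -(mulmxA _ (D^t*)) -/H [in LHS]gram_spectral.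
  by rewrite !mulmxA mulmxtVK.
rewrite /trace_norm /sqrtmx -/H -/Q -/s (invmx_unitary Qu).
congr (\tr (_ *m _ *m _)).
rewrite mulmx_diag; congr (diag_mx _).
(* For each eigenvalue this reads [sqrt s = (sqrt s)^-1 * s], which also holds at 0. *)
apply/rowP => i; rewrite !mxE; have [->|s0] := eqVneq (s 0 i) 0.
  by rewrite sqrtC0 mulr0.
by rewrite -[X in _ = _ * X]sqrtCK expr2 mulKf // sqrtC_eq0.
Qed.

(** With W the witness and [y = W^* x], the pairing is an inner product of [x] and [y], so
    [|y| <= |x|] is enough. In the eigenbasis [|y|^2] weighs the squared coordinates of [Q x] by
    [s_i r_i^2], which is 1 or, at a zero eigenvalue, 0. *)
Lemma dual_witness_contraction (x : 'cV[C]_d) :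
  `|\tr (dual_witness *m (x *m x^t*))| <= \tr (x *m x^t*).
Proof.
have Qu := spectral_unitarymx H.
set y := dual_witness^t* *m x.
have -> : \tr (dual_witness *m (x *m x^t*)) = \tr (x *m y^t*).
  by rewrite mxtrace_mulC -mulmxA /y adjmxM trmxCK.
apply: le_trans (le_mxtrace_mul_adjmx _ _) _.
suff yx : \tr (y *m y^t*) <= \tr (x *m x^t*).
  rewrite ler_pdivrMr ?ltr0n // mulr_natr mulr2n lerD2l //.
set z := diag_mx r *m (Q *m x).
have -> : y = (D *m Q^t*) *m z.
  rewrite /y !adjmxM !trmxCK /z !mulmxA; congr (_ *m _ *m _ *m _).
  apply/matrixP => i j; rewrite !mxE eq_sym; case: eqP => [->|_]; last first.
    by rewrite !mulr0n conjC0.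
  rewrite !mulr1n geC0_conj // invr_ge0 sqrtC_ge0.
  exact: gram_spectral_diag_ge0.
rewrite mxtrace_adjmx_gram -gram_spectral_diag.
have -> : \tr (x *m x^t*) = \tr ((Q *m x) *m (Q *m x)^t*).
  by rewrite adjmxM mulmxA -(mulmxA Q) mxtrace_unitary_conj.
rewrite mxtrace_mul_adjmx; apply: ler_sum => i _.
rewrite mul_diag_mx /z mul_diag_mx !mxE !big_ord1 !mxE.
rewrite -normCK normrM exprMn mulrA.
apply: ler_piMl; first exact: exprn_ge0.
have si := gram_spectral_diag_ge0 i.
rewrite -normrX exprVn sqrtCK normfV (ger0_norm si).
by have [->|s0] := eqVneq (s 0 i) 0; rewrite ?mul0r // divff.
Qed.

Lemma trace_norm_ge0 : 0 <= trace_norm D.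
Proof.
have Qu := spectral_unitarymx H.
rewrite /trace_norm /sqrtmx -/H -/Q -/s (invmx_unitary Qu).
rewrite mxtrace_mulC mulmxA (unitarymxP Qu) mul1mx mxtrace_diag.
apply: sumr_ge0 => i _; rewrite mxE sqrtC_ge0.
exact: gram_spectral_diag_ge0.
Qed.

Lemma trace_norm_dual :
  exists2 W : 'M[C]_d, trace_norm D = \tr (W *m D) &
    forall x : 'cV_d, `|\tr (W *m (x *m x^t*))| <= \tr (x *m x^t*).
Proof.
by exists dual_witness; [apply: mxtrace_dual_witness
                        |apply: dual_witness_contraction].
Qed.
End Duality.

End TraceNormDuality.

(** * Randomized programs *)

Local Open Scope complex_scope.

Section ProgTheory.
Variable R : realType.
Local Notation C := R[i].
Local Notation prog := (prog R).

(** Every branch counts, also those of weight 0; unlike membership in [results], this needs no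
    decidable equality on [A]. *)
Fixpoint surely A (p : prog A) (P : A -> Prop) : Prop :=
  match p with
  | Ret x => P x
  | Step q => surely q P
  | Sample _ _ q => forall v, surely (q v) P
  end.

(* Excludes sampling from the zero vector, whose normalized weights are all 0
   and do not form a probability distribution. *)
Fixpoint samplable A (p : prog A) : Prop :=
  match p with
  | Ret _ => True
  | Step q => samplable q
  | Sample _ a q => \sum_u `|a u| != 0 /\ forall v, samplable (q v)
  end.

Definition expC A (p : prog A) (X : A -> C) : C :=
  expectation p (X : A -> C^o).

Lemma surelyT A (p : prog A) (P : A -> Prop) : (forall x, P x) -> surely p P.
Proof. by move=> PT; elim: p => //=. Qed.

Lemma surely_bind A B (p : prog A) (f : A -> prog B) (P : B -> Prop) :
  surely p (fun x => surely (f x) P) -> surely (bind p f) P.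
Proof. by elim: p => [x|q IH|N a q IH] //= H v; apply: IH. Qed.

Lemma surely_impl A (p : prog A) (P Q : A -> Prop) :
  (forall x, P x -> Q x) -> surely p P -> surely p Q.
Proof.
move=> PQ; elim: p => [x|q IH|N a q IH] //=; first exact: PQ.
by move=> H v; apply: IH.
Qed.

Lemma surely_results (A : eqType) (p : prog A) (P : A -> Prop) :
  surely p P -> forall x, x \in results p -> P x.
Proof.
elim: p => [y|q IH|N a q IH] //=.
  by move=> Py x; rewrite inE => /eqP ->.
move=> H x /mapP [o /flattenP [s /mapP [v _ ->]]] /mapP [o' o'q -> ->] /=.
by apply: (IH v) => //; apply: map_f.
Qed.

Lemma surely_for_each I A (s : seq I) (body : I -> prog A) (P : A -> Prop) :
  (forall i, surely (body i) P) ->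
  surely (for_each s body)
    (fun w => size w = size s /\ forall n x0, (n < size s)%N -> P (nth x0 w n)).
Proof.
move=> Pb; elim: s => [|i s IH] //=.
apply/surely_bind; apply: surely_impl (Pb i) => x Px.
apply/surely_bind; apply: surely_impl IH => xs [szxs Pxs] /=.
by split=> [|[|n] x0 //=]; [rewrite szxs | rewrite ltnS; apply: Pxs].
Qed.

Lemma samplable_bind A B (p : prog A) (f : A -> prog B) :
  samplable p -> (forall x, samplable (f x)) -> samplable (bind p f).
Proof.
move=> pp pf; elim: p pp => [x|q IH|N a q IH] //= [a0 pq]; split=> // v.
exact: IH.
Qed.

Lemma samplable_for_each I A (s : seq I) (body : I -> prog A) :
  (forall i, samplable (body i)) -> samplable (for_each s body).
Proof.
move=> pb; elim: s => //= i s IH; apply: samplable_bind => // x.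
exact: samplable_bind.
Qed.

Lemma for_each_cons A I i (s : seq I) (body : I -> prog A) :
  for_each (i :: s) body =
  bind (body i)
    (fun x => bind (for_each s body) (fun xs => Step (Ret (x :: xs)))).
Proof. by []. Qed.

Lemma for_each_map A I J (h : I -> J) (s : seq I) (body : J -> prog A) :
  for_each (map h s) body = for_each s (body \o h).
Proof. by elim: s => //= i s ->. Qed.

Lemma runtime_bind A B (p : prog A) (f : A -> prog B) b :
  (forall x, runtime (f x) <= b)%N -> (runtime (bind p f) <= runtime p + b)%N.
Proof.
move=> fb; elim: p => [x|q IH|N a q IH] //=; rewrite addSn ltnS //.
apply/bigmax_leqP => v _; apply: leq_trans (IH v) _.
by rewrite leq_add2r (leq_bigmax v).
Qed.

(** Each iteration pays [b] for its body and one step for storing the result. *)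
Lemma runtime_for_each I A (s : seq I) (body : I -> prog A) b :
  (forall i, runtime (body i) <= b)%N ->
  (runtime (for_each s body) <= size s * b.+1)%N.
Proof.
move=> bb; elim: s => //= i s IH; rewrite mulSn.
apply: leq_trans (runtime_bind _ (b := (size s * b.+1).+1) _) _.
  move=> x; apply: leq_trans (runtime_bind _ (b := 1) _) _ => //.
  by rewrite addn1 ltnS.
by rewrite addnS addSn ltnS leq_add2r.
Qed.

(** * Linearity of the expectation *)

Section Expectation.
Variable V : lmodType C.

Lemma expectation_Ret A (x : A) (f : A -> V) : expectation (Ret x) f = f x.
Proof. by rewrite /expectation /= big_seq1 scale1r. Qed.

Lemma expectation_Sample A N (a : 'I_N -> C) (q : 'I_N -> prog A) (f : A -> V) :
  expectation (Sample a q) f =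
  \sum_v (`|a v| / \sum_u `|a u|) *: expectation (q v) f.
Proof.
rewrite /expectation /= big_flatten big_map big_enum /=; apply: eq_bigr => v _.
by rewrite big_map scaler_sumr; apply: eq_bigr => o _; rewrite scalerA.
Qed.

Lemma expectation_bind A B (p : prog A) (f : A -> prog B) (g : B -> V) :
  expectation (bind p f) g = expectation p (fun x => expectation (f x) g).
Proof.
elim: p => [x|q IH|N a q IH]; rewrite ?expectation_Ret // ?expectation_Sample.
by apply: eq_bigr => v _; rewrite /= IH.
Qed.

Lemma eq_expectation_surely A (p : prog A) (f g : A -> V) :
  surely p (fun x => f x = g x) -> expectation p f = expectation p g.
Proof.
elim: p => [x|q IH|N a q IH] /=;
  rewrite ?expectation_Ret // ?expectation_Sample.
by move=> H; apply: eq_bigr => v _; rewrite IH.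
Qed.

Lemma eq_expectation A (p : prog A) (f g : A -> V) :
  f =1 g -> expectation p f = expectation p g.
Proof. by move=> fg; apply/eq_expectation_surely/surelyT. Qed.

(** The weights have to add up to 1 here: [samplable] makes the normalizing denominator nonzero at
    each draw. *)
Lemma expectation_cst A (p : prog A) (c : V) :
  samplable p -> expectation p (fun=> c) = c.
Proof.
elim: p => [x|q IH|N a q IH] /=;
  rewrite ?expectation_Ret ?expectation_Sample //.
move=> [a0 pq]; under eq_bigr => v _ do rewrite IH //.
by rewrite -scaler_suml -mulr_suml divff ?scale1r.
Qed.

Lemma expectationD A (p : prog A) (f g : A -> V) :
  expectation p (fun x => f x + g x) = expectation p f + expectation p g.
Proof.
by rewrite /expectation -big_split; apply: eq_bigr => o _; rewrite /= scalerDr.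
Qed.

Lemma expectation_sum A (p : prog A) (M : finType) (f : M -> A -> V) :
  expectation p (fun x => \sum_m f m x) = \sum_m expectation p (f m).
Proof.
rewrite /expectation exchange_big; apply: eq_bigr => o _.
by rewrite scaler_sumr.
Qed.

Lemma expectation_linear (W : lmodType C) A (p : prog A) (L : {linear V -> W})
  (f : A -> V) : expectation p (fun x => L (f x)) = L (expectation p f).
Proof.
by rewrite /expectation linear_sum; apply: eq_bigr => o _; rewrite linearZ.
Qed.

Lemma expectationZ A (p : prog A) (c : C) (f : A -> V) :
  expectation p (fun x => c *: f x) = c *: expectation p f.
Proof.
rewrite /expectation scaler_sumr; apply: eq_bigr => o _.
by rewrite !scalerA mulrC.
Qed.

Lemma expectationB A (p : prog A) (f g : A -> V) :
  expectation p (fun x => f x - g x) = expectation p f - expectation p g.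
Proof.
rewrite expectationD; congr (_ + _); rewrite -scaleN1r -expectationZ.
by apply: eq_expectation => x; rewrite scaleN1r.
Qed.

End Expectation.

Lemma expectation_mulmxl m n q A (p : prog A) (B : 'M[C]_(m, n))
    (f : A -> 'M_(n, q)) :
  expectation p (fun x => B *m f x) = B *m expectation p f.
Proof. exact: (expectation_linear p (mulmx B)). Qed.

Lemma expectation_mulmxr m n q A (p : prog A) (B : 'M[C]_(n, q))
    (f : A -> 'M_(m, n)) :
  expectation p (fun x => f x *m B) = expectation p f *m B.
Proof. exact: (expectation_linear p (mulmxr B)). Qed.

Lemma expectation_mxtrace n A (p : prog A) (f : A -> 'M[C]_n) :
  expC p (fun x => \tr (f x)) = \tr (expectation p f).
Proof. exact: (expectation_linear p (@mxtrace C n : 'M_n -> C^o)). Qed.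

Lemma expCD A (p : prog A) (X Y : A -> C) :
  expC p (fun x => X x + Y x) = expC p X + expC p Y.
Proof. exact: (@expectationD C^o). Qed.

Lemma expC_cst A (p : prog A) (c : C) : samplable p -> expC p (fun=> c) = c.
Proof. exact: (@expectation_cst C^o). Qed.

Lemma eq_variance_surely A (p : prog A) (X Y : A -> C) :
  surely p (fun x => X x = Y x) -> variance p X = variance p Y.
Proof.
move=> XY; rewrite /variance (@eq_expectation_surely C^o _ p X Y) //.
by apply: eq_expectation_surely; apply: surely_impl XY => x ->.
Qed.

Lemma weight_ge0 N (a : 'I_N -> C) v : 0 <= `|a v| / \sum_u `|a u|.
Proof. by rewrite divr_ge0 // sumr_ge0. Qed.

Lemma expectation_adjmx m n A (p : prog A) (f : A -> 'M[C]_(m, n)) :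
  expectation p (fun x => (f x)^t*) = (expectation p f)^t*.
Proof.
elim: p => [x|q IH|N a q IH]; rewrite ?expectation_Ret // ?expectation_Sample.
rewrite linear_sum raddf_sum; apply: eq_bigr => v _.
by rewrite /= IH adjmxZ geC0_conj ?weight_ge0.
Qed.

Lemma le_expC A (p : prog A) (X Y : A -> C) :
  surely p (fun x => X x <= Y x) -> expC p X <= expC p Y.
Proof.
rewrite /expC; elim: p => [x|q IH|N a q IH] /=;
  rewrite ?expectation_Ret // ?expectation_Sample.
by move=> XY; apply: ler_sum => v _; apply: ler_wpM2l; rewrite ?weight_ge0 ?IH.
Qed.

Lemma expC_ge0 A (p : prog A) (X : A -> C) :
  (forall x, 0 <= X x) -> 0 <= expC p X.
Proof.
rewrite /expC; elim: p => [x|q IH|N a q IH] X0;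
  rewrite ?expectation_Ret // ?expectation_Sample; first exact: IH.
by apply: sumr_ge0 => v _; rewrite mulr_ge0 ?weight_ge0 ?IH.
Qed.

Lemma ler_norm_expC A (p : prog A) (X : A -> C) :
  `|expC p X| <= expC p (fun x => `|X x|).
Proof.
rewrite /expC; elim: p => [x|q IH|N a q IH];
  rewrite ?expectation_Ret // ?expectation_Sample.
apply: le_trans (ler_norm_sum _ _ _) _; apply: ler_sum => v _.
by rewrite normrM (ger0_norm (weight_ge0 _ _)) ler_wpM2l ?weight_ge0.
Qed.

(** The variance of [|X|] is nonnegative: expanding [E (|X| - m)^2] with [m = E |X|] gives
    [E |X|^2 - m^2]. *)
Lemma expC_norm_le_sqrt A (p : prog A) (X : A -> C) : samplable p ->
  expC p (fun x => `|X x|) <= sqrtC (expC p (fun x => `|X x| ^+ 2)).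
Proof.
move=> pp; set m := expC p (fun x => `|X x|).
have m0 : 0 <= m by apply: expC_ge0.
rewrite -(ler_sqr (x := m)) ?nnegrE ?sqrtC_ge0 ?sqrtCK //; last first.
  by apply: expC_ge0 => x; rewrite exprn_ge0.
have : 0 <= expC p (fun x => (`|X x| - m) ^+ 2).
  apply: expC_ge0 => x; rewrite real_exprn_even_ge0 // realB ?normr_real //.
  exact: ger0_real.
have -> : expC p (fun x => (`|X x| - m) ^+ 2) =
    expC p (fun x => `|X x| ^+ 2) - m ^+ 2.
  have sqrE x : (`|X x| - m) ^+ 2 =
      `|X x| ^+ 2 + (m ^+ 2 - 2 * m * `|X x|) :> C by ring.
  rewrite /expC (eq_expectation (V := C^o) p sqrE).
  rewrite expectationD expectationB expectation_cst //.
  rewrite (expectationZ p (2 * m) (fun x => `|X x| : C^o)) -/m.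
  have -> : (2 * m) *: (m : C^o) = m ^+ 2 *+ 2 :> C.
    by rewrite /GRing.scale /=; ring.
  by rewrite mulr2n opprD addNKr.
by rewrite subr_ge0.
Qed.

(* Second moments of the sum of independent copies of [X]: the diagonal terms
   contribute the second moment of [X], the off-diagonal ones its mean. *)
Section IndependentSum.
Variables (A I : Type) (p : prog A) (n : nat) (X : A -> 'cV[C]_n).
Hypothesis pp : samplable p.
Let mu := expectation p X.

Lemma expectation_for_each_sum (s : seq I) :
  expectation (for_each s (fun=> p)) (fun d => \sum_(w <- d) X w) =
  mu *+ size s.
Proof.
elim: s => [|i s IH] /=; first by rewrite expectation_Ret big_nil mulr0n.
rewrite expectation_bind mulrS -IH -[mu + _]/(expectation p X + _).
rewrite -[X in _ = _ + X](expectation_cst _ pp) -expectationD.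
apply: eq_expectation => x; rewrite expectation_bind.
rewrite -[X in _ = X + _](expectation_cst _ (p := for_each s (fun=> p))).
  rewrite -expectationD; apply: eq_expectation => d.
  by rewrite [LHS]expectation_Ret big_cons.
exact: samplable_for_each.
Qed.

Lemma expectation_for_each_sqr (s : seq I) :
  expectation (for_each s (fun=> p))
    (fun d => (\sum_(w <- d) X w) *m (\sum_(w <- d) X w)^t*) =
  expectation p (fun x => X x *m (X x)^t*) *+ size s
  + mu *m mu^t* *+ (size s * (size s).-1).
Proof.
elim: s => [|i s IH] /=.
  by rewrite expectation_Ret big_nil mul0mx mulr0n muln0 mulr0n addr0.
rewrite expectation_bind.
have ps : samplable (for_each s (fun=> p)) by apply: samplable_for_each.
set S := fun d : seq A => \sum_(w <- d) X w.
have ES : expectation (for_each s (fun=> p)) S = mu *+ size s.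
  exact: expectation_for_each_sum.
(* The conditional expectation of the squared sum given the first sample [x]: one square, two cross
   terms with the mean of the remaining sum, and the inductive value for the rest. *)
pose F x : 'M[C]_n := X x *m (X x)^t* + (X x *m (mu *+ size s)^t*
  + ((mu *+ size s) *m (X x)^t*
  + (expectation p (fun x => X x *m (X x)^t*) *+ size s
     + mu *m mu^t* *+ (size s * (size s).-1)))).
transitivity (expectation p F).
  apply: eq_expectation => x; rewrite expectation_bind /F -IH -ES.
  rewrite -expectation_adjmx -expectation_mulmxl -expectation_mulmxr.
  rewrite -[X in X + _](expectation_cst _ ps) -!expectationD.
  apply: eq_expectation => d; rewrite [LHS]expectation_Ret /S big_cons.
  by rewrite adjmxD mulmxDl !mulmxDr -!addrA.
rewrite /F !expectationD expectation_mulmxl expectation_mulmxr.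
rewrite expectation_adjmx !expectation_cst //.
rewrite -/mu; have -> : (mu *+ size s)^t* = mu^t* *+ size s.
  by rewrite raddfMn /= raddfMn.
have -> : mu *m (mu^t* *+ size s) = mu *m mu^t* *+ size s.
  exact: (raddfMn (mulmx mu)).
have -> : mu *+ size s *m mu^t* = mu *m mu^t* *+ size s.
  exact: (raddfMn (mulmxr (mu^t*))).
set P := mu *m _; set Q := expectation p _; rewrite mulrS -!addrA.
congr (_ + _); rewrite [Q *+ _ + P *+ _]addrC !addrA [RHS]addrC.
congr (_ + _).
(* Ordered pairs of distinct copies: with [l = size s], the two cross terms turn [l (l - 1)] into
   [(l + 1) l]. *)
rewrite -!mulrnDr; congr (_ *+ _).
by case: (size s) => //= k; rewrite !mulSn !mulnS; lia.
Qed.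

End IndependentSum.

End ProgTheory.

(** * Error of a normalized mean of independent samples *)

Section SparsificationError.
Variables (R : realType) (A I : Type) (M : finType) (n : nat).
Local Notation C := R[i].
Variables (p : prog R A) (X : M -> A -> 'cV[C]_n) (s : seq I) (c2 : C).
Hypotheses (pp : samplable p) (s_gt0 : (0 < size s)%N).
Let k : C := (size s)%:R.
Let P := for_each s (fun=> p).
Let psi m := expectation p (X m).
Let Y m d := k^-1 *: \sum_(w <- d) X m w.
Let Om d := \sum_m Y m d *m (Y m d)^t*.
Let sigma := \sum_m psi m *m (psi m)^t*.
Let G := \sum_m expectation p (fun w => X m w *m (X m w)^t*).
Hypothesis sigma1 : \tr sigma = 1.
Hypothesis Xc2 : surely p (fun w => \sum_m \tr (X m w *m (X m w)^t*) <= c2).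

Let k_gt0 : 0 < k. Proof. by rewrite ltr0n. Qed.

Let samplableP : samplable P. Proof. exact: samplable_for_each. Qed.

Lemma expectation_sparsified : expectation P Om = sigma + k^-1 *: (G - sigma).
Proof.
rewrite /Om expectation_sum /G /sigma -sumrB scaler_sumr -big_split /=.
apply: eq_bigr => m _; rewrite -/(psi m).
set S := fun d : seq A => \sum_(w <- d) X m w.
transitivity (expectation P (fun d => (k^-1 ^+ 2) *: (S d *m (S d)^t*))).
  apply: eq_expectation => d; rewrite /Y adjmxZ -scalemxAl -scalemxAr scalerA.
  by rewrite geC0_conj ?invr_ge0 ?(ltW k_gt0) // -expr2.
rewrite expectationZ expectation_for_each_sqr // -/(psi m).
set B := expectation p _; set D := psi m *m _.
rewrite -[B *+ _]scaler_nat -[D *+ _]scaler_nat scalerDr !scalerA.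
have k0 : k != 0 by rewrite gt_eqF.
(* The [k] diagonal and [k (k - 1)] off-diagonal pairs, divided by [k^2], get the weights [1/k] and
   [1 - 1/k]. *)
have -> : k^-1 ^+ 2 * (size s)%:R = k^-1 by rewrite -/k; field.
have -> : k^-1 ^+ 2 * (size s * (size s).-1)%:R = 1 - k^-1.
  by rewrite natrM -subn1 natrB // -/k; field.
by rewrite scalerBl scale1r scalerBr addrCA.
Qed.

Let q := \tr G.

Lemma mxtrace_second_moment :
  q = expC p (fun w => \sum_m \tr (X m w *m (X m w)^t*)).
Proof.
rewrite /q /G raddf_sum /= [RHS](@expectation_sum _ C^o).
by apply: eq_bigr => m _; rewrite -expectation_mxtrace.
Qed.

Lemma second_moment_le : q <= c2.
Proof. by rewrite mxtrace_second_moment -(expC_cst c2 pp) le_expC. Qed.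

(** [G - sigma] is the sum over [m] of the covariance matrices of [X m], whose traces are
    nonnegative, and [sigma] has trace 1. *)
Lemma second_moment_ge1 : 1 <= q.
Proof.
rewrite -sigma1 -subr_ge0 /q -raddfB /= /G /sigma -sumrB raddf_sum.
apply: sumr_ge0 => m _ /=; set mu := psi m.
have -> : expectation p (fun w => X m w *m (X m w)^t*) - mu *m mu^t* =
    expectation p (fun w => (X m w - mu) *m (X m w - mu)^t*).
  transitivity (expectation p (fun w => X m w *m (X m w)^t* -
      (X m w *m mu^t* + (mu *m (X m w)^t* - mu *m mu^t*)))).
    rewrite expectationB expectationD expectationB expectation_mulmxr.
    rewrite expectation_mulmxl expectation_adjmx expectation_cst //.
    by rewrite subrr addr0.
  apply: eq_expectation => w; rewrite adjmxD mulmxDl !mulmxDr.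
  have -> : (- mu)^t* = - mu^t* by rewrite raddfN /= raddfN.
  by rewrite !mulNmx !mulmxN opprK !opprD opprK !addrA.
rewrite -expectation_mxtrace; apply: expC_ge0 => w.
exact: mxtrace_mul_adjmx_ge0.
Qed.

Let Om_ge0 d : 0 <= \tr (Om d).
Proof.
by rewrite raddf_sum sumr_ge0 // => m _; apply: mxtrace_mul_adjmx_ge0.
Qed.

Lemma mean_mxtrace_sparsified : expC P (fun d => \tr (Om d)) = 1 + (q - 1) / k.
Proof.
rewrite expectation_mxtrace expectation_sparsified mxtraceD mxtraceZ raddfB /=.
by rewrite sigma1 -/q mulrC.
Qed.

Lemma mean_dist_mxtrace_sparsified :
  expC P (fun d => `|1 - \tr (Om d)|) <=
  (q - 1) / k + sqrtC (variance P (fun d => \tr (Om d))).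
Proof.
set m := expC P (fun d => \tr (Om d)).
have qk : 0 <= (q - 1) / k.
  by rewrite divr_ge0 ?(ltW k_gt0) // subr_ge0 second_moment_ge1.
apply: le_trans (_ : expC P (fun d => (q - 1) / k + `|\tr (Om d) - m|) <= _).
  apply: le_expC; apply: surelyT => d.
  (* Split into the bias of the mean trace and the fluctuation around that mean; the latter is
     bounded by the standard deviation. *)
  have -> : 1 - \tr (Om d) = - ((q - 1) / k) - (\tr (Om d) - m).
    by rewrite /m mean_mxtrace_sparsified; ring.
  by apply: le_trans (ler_normB _ _) _; rewrite normrN (ger0_norm qk).
rewrite expCD expC_cst // lerD2l.
exact: expC_norm_le_sqrt.
Qed.

(** * Pairing the error with a contraction *)

Section Pairing.
Variable W : 'M[C]_n.
Hypothesis WC : forall x : 'cV_n, `|\tr (W *m (x *m x^t*))| <= \tr (x *m x^t*).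

Let pairing_sum (J : finType) (x : J -> 'cV_n) :
  `|\tr (W *m \sum_j x j *m (x j)^t*)| <= \tr (\sum_j x j *m (x j)^t*).
Proof.
rewrite mulmx_sumr !raddf_sum; apply: le_trans (ler_norm_sum _ _ _) _.
by apply: ler_sum => j _; apply: WC.
Qed.

(** Normalizing multiplies [Om d] by [1/t], and the pairing with [Om d] is at most its trace [t], so
    the change is at most [|1/t - 1| t = |1 - t|]. *)
Lemma pairing_normalization d :
  `|\tr (W *m (normalized (Om d) - Om d))| <= `|1 - \tr (Om d)|.
Proof.
set t := \tr (Om d); have t0 : 0 <= t := Om_ge0 d.
have -> : normalized (Om d) - Om d = (t^-1 - 1) *: Om d.
  by rewrite scalerBl scale1r.
rewrite -scalemxAr mxtraceZ normrM.
(* For [t = 0] the scalar [t^-1 - 1] is -1, but the pairing with [Om d] is bounded by [t] and hence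
   vanishes. *)
have [te|tn] := eqVneq t 0.
  have := pairing_sum (Y ^~ d); rewrite -/(Om d) -/t te => W0.
  have -> : `|\tr (W *m Om d)| = 0 by apply: le_anti; rewrite W0 normr_ge0.
  by rewrite mulr0.
have -> : `|1 - t| = `|t^-1 - 1| * t.
  by rewrite -{3}(ger0_norm t0) -normrM mulrBl mulVf // mul1r.
by rewrite ler_wpM2l // pairing_sum.
Qed.

Lemma pairing_second_moment : `|\tr (W *m G)| <= q.
Proof.
rewrite mulmx_sumr raddf_sum /q /G raddf_sum /=.
apply: le_trans (ler_norm_sum _ _ _) _; apply: ler_sum => m _.
rewrite -expectation_mulmxl -!expectation_mxtrace.
apply: le_trans (ler_norm_expC _ _) _; apply: le_expC.
by apply: surelyT => w; apply: WC.
Qed.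

Lemma pairing_error :
  `|\tr (W *m (expectation P (fun d => normalized (Om d)) - sigma))| <=
  2 * (c2 / k) + sqrtC (variance P (fun d => \tr (Om d))).
Proof.
set rho1 := expectation P _.
have -> : rho1 - sigma = (rho1 - expectation P Om) + k^-1 *: (G - sigma).
  by rewrite expectation_sparsified opprD !addrA subrK.
rewrite mulmxDr mxtraceD; apply: le_trans (ler_normD _ _) _.
set V := sqrtC _.
(* The first summand pays for normalization, the second for the bias [(G - sigma)/k]; the constants
   -1 and +1 cancel. *)
apply: le_trans (_ : ((q - 1) / k + V) + (q + 1) / k <= _); last first.
  have -> : (q - 1) / k + V + (q + 1) / k = 2 * (q / k) + V by ring.
  rewrite lerD2r ler_wpM2l // ler_wpM2r ?invr_ge0 ?(ltW k_gt0) //.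
  exact: second_moment_le.
apply: lerD.
  rewrite /rho1 -expectationB -expectation_mulmxl -expectation_mxtrace.
  apply: le_trans (ler_norm_expC _ _) _.
  apply: le_trans mean_dist_mxtrace_sparsified; apply: le_expC.
  by apply: surelyT => d; apply: pairing_normalization.
rewrite -scalemxAr mxtraceZ normrM normfV (gtr0_norm k_gt0) mulrC.
rewrite ler_wpM2r ?invr_ge0 ?(ltW k_gt0) // mulmxBr raddfB /=.
apply: le_trans (ler_normB _ _) _; apply: lerD.
  exact: pairing_second_moment.
by rewrite -sigma1; apply: pairing_sum.
Qed.

End Pairing.

Lemma trace_norm_error :
  trace_norm (expectation P (fun d => normalized (Om d)) - sigma) <=
  2 * (c2 / k) + sqrtC (variance P (fun d => \tr (Om d))).
Proof.
set D := _ - _; have [W WD WC] := trace_norm_dual D.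
rewrite -[trace_norm D]ger0_norm ?trace_norm_ge0 // WD.
exact: pairing_error.
Qed.

End SparsificationError.

(** * Kraus expansion and Gaussian states *)

Section Iteration.

Lemma foldl_map A B Z (f : Z -> B -> Z) (h : A -> B) z (s : seq A) :
  foldl f z (map h s) = foldl (fun z x => f z (h x)) z s.
Proof. by elim: s z => /=. Qed.

Lemma eq_foldl A Z (f g : Z -> A -> Z) :
  f =2 g -> foldl f =2 foldl g.
Proof. by move=> fg z s; elim: s z => //= x s IH z; rewrite fg. Qed.

Lemma foldl_ind A Z (f : Z -> A -> Z) (Q : Z -> Prop) (s : seq A) z :
  (forall z x, Q z -> Q (f z x)) -> Q z -> Q (foldl f z s).
Proof. by move=> fQ; elim: s z => //= x s IH z Qz; apply/IH/fQ. Qed.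

Lemma foldl_mulmx (C : comPzRingType) n I (A : I -> 'M[C]_n) (S : 'M_n) s :
  foldl (fun S i => A i *m S) S s = foldl (fun S i => A i *m S) 1%:M s *m S.
Proof.
elim: s S => [|i s IH] S /=; first by rewrite mul1mx.
by rewrite IH [in RHS]IH mulmx1 mulmxA.
Qed.

Lemma foldl_scale_mulmx (C : comPzRingType) n I (c : I -> C) (A : I -> 'M[C]_n)
    c0 (S : 'M_n) s :
  foldl (fun S i => (c i *: A i) *m S) (c0 *: S) s =
  (c0 * \prod_(i <- s) c i) *: foldl (fun S i => A i *m S) S s.
Proof.
elim: s c0 S => [|i s IH] c0 S /=; first by rewrite big_nil mulr1.
by rewrite -scalemxAl -scalemxAr scalerA IH big_cons mulrA [c0 * _]mulrC.
Qed.

Lemma zip_enum_ord A T (x0 : A) (w : seq A) : size w = T ->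
  zip (enum 'I_T) w = [seq (t, nth x0 w t) | t : 'I_T <- enum 'I_T].
Proof.
case: T => [|T] sw.
  have -> : enum 'I_0 = [::] by apply: size0nil; rewrite size_enum_ord.
  by case: w sw.
apply: (@eq_from_nth _ (ord0, x0)).
  by rewrite size_zip size_map size_enum_ord sw minnn.
move=> j; rewrite size_zip size_enum_ord sw minnn => jT.
rewrite nth_zip ?size_enum_ord // (nth_map ord0) ?size_enum_ord //.
by rewrite nth_enum_ord.
Qed.

Definition ffun_cons B T (b : B) (m : {ffun 'I_T -> B}) : {ffun 'I_T.+1 -> B} :=
  [ffun t => if unlift ord0 t is Some t' then m t' else b].

Lemma sum_ffun_cons (V : nmodType) (B : finType) T
    (F : {ffun 'I_T.+1 -> B} -> V) :
  \sum_m F m = \sum_b \sum_m F (ffun_cons b m).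
Proof.
rewrite pair_big.
rewrite (reindex (fun bm : B * {ffun 'I_T -> B} => ffun_cons bm.1 bm.2)) //.
exists (fun m : {ffun 'I_T.+1 -> B} => (m ord0, [ffun t => m (lift ord0 t)])).
  move=> [b m] _ /=; rewrite ffunE unlift_none; congr (_, _).
  by apply/ffunP => t; rewrite !ffunE liftK.
move=> m _; apply/ffunP => t; rewrite ffunE /=.
by case: unliftP => [t' ->|->]; rewrite ?ffunE.
Qed.

(** The inner sums are rewritten over the tagged union of the [J i], where distributivity for
    ordinary functions applies; [fprod] leads back to dependent ones. It yields the factorization of
    the 1-norm of [c] over the gates. *)
Lemma bigA_distr_dffun (C : comPzSemiRingType) (I : finType) (J : I -> finType)
    (F : forall i, J i -> C) :
  \prod_i \sum_j F i j = \sum_(f : {dffun forall i, J i}) \prod_i F i (f i).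
Proof.
rewrite (reindex (@dffun_of_fprod _ J)); last first.
  by apply: onW_bij; apply: dffun_of_fprod_bij.
pose P i : {ffun J i -> C} := [ffun j => F i j].
transitivity (\prod_i \sum_j P i j).
  by apply: eq_bigr => i _; apply: eq_bigr => j _; rewrite ffunE.
under eq_bigr => i _ do rewrite (big_tag (fun i => P i)).
rewrite bigA_distr_big_dep -big_fprod; apply: eq_bigr => f _.
by apply: eq_bigr => i _; rewrite !ffunE.
Qed.

Lemma partition_big_undup (V : nmodType) (A B : eqType) (s : seq A) (h : A -> B)
    (F : A -> V) :
  \sum_(x <- s) F x = \sum_(y <- undup (map h s)) \sum_(x <- s | h x == y) F x.
Proof.
rewrite (exchange_big_dep xpredT) //= big_seq [RHS]big_seq.
apply: eq_bigr => x xs; rewrite big_mkcond (bigD1_seq (h x)) ?undup_uniq //=.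
  by rewrite eqxx big1 ?addr0 // => y; rewrite eq_sym => /negPf ->.
by rewrite mem_undup map_f.
Qed.

End Iteration.

(** * Gaussian states, Kraus expansion and independent factors *)

Section GaussianTheory.
Variables (R : realType).
Local Notation C := R[i].

Lemma adjoint_action_ketbra n (S : 'M[C]_(2 ^ n)) (phi : 'cV_(2 ^ n)) :
  adjoint_action S (ketbra phi) = ketbra (S *m phi).
Proof. by rewrite /adjoint_action /ketbra adjmxM !mulmxA. Qed.

Lemma tensmx_adj m n p q (A : 'M[C]_(m, n)) (B : 'M[C]_(p, q)) :
  (A *t B)^t* = A^t* *t B^t*.
Proof. by rewrite trmx_tens map_mxT. Qed.

Lemma ntensmx_isometry m (v : 'cV[C]_m) k :
  v^t* *m v = 1%:M -> (ntensmx v k)^t* *m ntensmx v k = 1%:M.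
Proof.
move=> v1; case: k => [|k] /=; first by rewrite trmx1 map_mx1 mulmx1.
elim: k => [|k IH] //=; rewrite tensmx_adj tensmx_mul v1 IH.
by rewrite tens_scalar1mx; apply/matrixP => i j; rewrite castmxE !mxE.
Qed.

Lemma mxtrace_ketbra_ket0 n : \tr (ketbra (ket0 R n)) = 1.
Proof.
rewrite /ketbra /ket0.
(* [1 ^ n] does not reduce for a variable [n]; with a general target dimension the cast can be
   eliminated. *)
have castE p (e : (1 ^ n = p)%N) (v : 'M[C]_(2 ^ n, 1 ^ n)) :
  \tr (castmx (erefl, e) v *m (castmx (erefl, e) v)^t*) = \tr (v^t* *m v).
  by case: _ / e; rewrite castmx_id mxtrace_mulC.
rewrite castE ntensmx_isometry ?mxtrace1 ?exp1n //.
apply/matrixP => i j; rewrite !ord1 !mxE big_ord_recl big_ord1 !mxE /=.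
by rewrite conjC1 conjC0 mulr1 mul0r addr0.
Qed.

Lemma gaussian_state_trace1 n (phi : 'cV[C]_(2 ^ n)) :
  gaussian_state phi -> \tr (ketbra phi) = 1.
Proof.
move=> [U [Uu _] ->]; rewrite -adjoint_action_ketbra mxtrace_unitary_conj //.
exact: mxtrace_ketbra_ket0.
Qed.

Lemma gaussian_unitaryM n (U V : 'M[C]_(2 ^ n)) :
  gaussian_unitary U -> gaussian_unitary V -> gaussian_unitary (U *m V).
Proof.
move=> [Uu [QU QUo UE]] [Vu [QV QVo VE]].
have UVu := mul_unitarymx Uu Vu.
split=> //.
(* The order is reversed: conjugation by [V] acts first and expands [majorana j] along row [j] of
   [QV]. *)
exists (QV *m QU).
  by rewrite trmx_mul mulmxA -(mulmxA QV) QUo mulmx1.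
move=> j; rewrite adjmxM !mulmxA -(mulmxA U) -(mulmxA U) VE.
rewrite mulmx_sumr mulmx_suml.
under eq_bigr => l _ do rewrite -scalemxAr -scalemxAl UE scaler_sumr.
rewrite exchange_big; apply: eq_bigr => i _.
rewrite mxE rmorph_sum /= scaler_suml; apply: eq_bigr => l _.
by rewrite scalerA rmorphM.
Qed.

Lemma gaussian_unitary_state n (U : 'M[C]_(2 ^ n)) (phi : 'cV_(2 ^ n)) :
  gaussian_unitary U -> gaussian_state phi -> gaussian_state (U *m phi).
Proof.
move=> gU [V gV ->]; exists (U *m V); last by rewrite mulmxA.
exact: gaussian_unitaryM.
Qed.

Lemma kraus_map_sum n (K : bool -> 'M[C]_(2 ^ n)) (J : finType)
    (rho : J -> 'M_(2 ^ n)) :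
  kraus_map K (\sum_j rho j) = \sum_j kraus_map K (rho j).
Proof.
rewrite /kraus_map exchange_big; apply: eq_bigr => b _.
by rewrite /adjoint_action mulmx_sumr mulmx_suml.
Qed.

Lemma foldl_channel_sum n I (N : I -> 'M[C]_(2 ^ n))
    (K : I -> bool -> 'M[C]_(2 ^ n)) (J : finType) (rho : J -> 'M_(2 ^ n)) s :
  foldl (fun sigma i => adjoint_action (N i) (kraus_map (K i) sigma))
    (\sum_j rho j) s =
  \sum_j foldl (fun sigma i => adjoint_action (N i) (kraus_map (K i) sigma))
    (rho j) s.
Proof.
elim: s rho => //= i s IH rho; rewrite -IH kraus_map_sum.
by rewrite /adjoint_action mulmx_sumr mulmx_suml.
Qed.

(** Induction on [T], splitting off the first outcome [b]: the start [S] becomes [N_0 K_{0,b} S],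
    and linearity moves the sum over [b] through the remaining channels. The arbitrary [N] covers
    both the exact and the sampled gates. *)
Lemma kraus_expansion n T (N : 'I_T -> 'M[C]_(2 ^ n))
    (K : 'I_T -> bool -> 'M[C]_(2 ^ n)) (S rho : 'M_(2 ^ n)) :
  \sum_(m : {ffun 'I_T -> bool})
    adjoint_action (foldl (fun S t => N t *m K t (m t) *m S) S (enum 'I_T))
      rho =
  foldl (fun sigma t => adjoint_action (N t) (kraus_map (K t) sigma))
    (adjoint_action S rho) (enum 'I_T).
Proof.
elim: T N K S => [|T IH] N K S.
  (* For [T = 0] the empty function is the only outcome pattern. *)
  rewrite (bigD1 [ffun=> false]) //= big1 ?addr0; last first.
    by move=> m /eqP []; apply/ffunP => -[].
  by have -> : enum 'I_0 = [::] by apply: size0nil; rewrite size_enum_ord.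
rewrite sum_ffun_cons enum_ordSl /= foldl_map.
have -> : adjoint_action (N ord0) (kraus_map (K ord0) (adjoint_action S rho)) =
    \sum_b adjoint_action (N ord0 *m K ord0 b *m S) rho.
  rewrite /kraus_map /adjoint_action mulmx_sumr mulmx_suml.
  by apply: eq_bigr => b _; rewrite !adjmxM !mulmxA.
rewrite foldl_channel_sum; apply: eq_bigr => b _; rewrite -IH.
apply: eq_bigr => m _; rewrite ffunE unlift_none foldl_map.
pose step (b' : bool) (S' : 'M_(2 ^ n)) (t : 'I_T) :=
  N (lift ord0 t) *m K (lift ord0 t) b' *m S'.
have stepE : (fun S' t => step (ffun_cons b m (lift ord0 t)) S' t) =2
    (fun S' t => step (m t) S' t) by move=> S' t; rewrite ffunE liftK.
by rewrite (eq_foldl stepE).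
Qed.

(** Independence: the mean of a product of separately drawn factors is the product of their means.
    [foldl_mulmx] detaches the first factor from the rest. *)
Lemma expectation_foldl A I n (s : seq I) (body : I -> prog R A)
    (g : I -> A -> 'M[C]_n) (S : 'M_n) :
  expectation (for_each s body)
    (fun w => foldl (fun S ix => g ix.1 ix.2 *m S) S (zip s w)) =
  foldl (fun S i => expectation (body i) (g i) *m S) S s.
Proof.
elim: s S => [|i s IH] S /=; first by rewrite expectation_Ret.
rewrite expectation_bind foldl_mulmx mulmxA -expectation_mulmxl.
rewrite -expectation_mulmxr; apply: eq_expectation => x.
rewrite -mulmxA -foldl_mulmx -IH expectation_bind.
by apply: eq_expectation => w; rewrite [LHS]expectation_Ret.
Qed.

End GaussianTheory.

(** * Sparsified circuits *)

Section CircuitSparsification.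
Variables (R : realType) (n T : nat) (E : circuit R n T).
Local Notation C := R[i].
Local Notation N t := (\sum_v `|@coef _ _ _ E t v|).
Local Notation outcome := (C * 'M[C]_(2 ^ n))%type.

(** The modulus is only bounded by 1, since a zero coefficient yields phase 0. *)
Definition valid_gate (g : outcome) := `|g.1| <= 1 /\ gaussian_unitary g.2.

Definition valid_term (w : term_description R n) :=
  size w = T.+1 /\
  forall j x0, (j < T.+1)%N -> valid_gate (nth x0 w j).

Local Notation sample_term := (for_each (enum 'I_T.+1) (sample_gate E)).

(** Otherwise all coefficients vanish and the gate is 0, which is not unitary in the nonzero
    dimension [2 ^ n]. *)
Lemma norm1_gate_neq0 t : N t != 0.
Proof.
apply/eqP => /eqP; rewrite psumr_eq0 // => /allP N0.
have U0 : gate E t = 0.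
  rewrite gate_decomposition big1 // => v _.
  have := N0 v (mem_index_enum _); rewrite /= normr_eq0 => /eqP ->.
  by rewrite scale0r.
have /unitarymxP := gate_unitary E t; rewrite U0 mul0mx.
move=> /(congr1 mxtrace) /eqP.
by rewrite mxtrace0 mxtrace1 eq_sym pnatr_eq0 expn_eq0.
Qed.

Lemma coef_norm1E : coef_norm1 E = \prod_t N t.
Proof.
by rewrite bigA_distr_dffun; apply: eq_bigr => v _; rewrite normr_prod.
Qed.

Lemma coef_norm1_ge0 : 0 <= coef_norm1 E.
Proof. exact: sumr_ge0. Qed.

Lemma coef_norm1_neq0 : coef_norm1 E != 0.
Proof.
by rewrite coef_norm1E; apply/prodf_neq0 => t _; apply: norm1_gate_neq0.
Qed.

Lemma samplable_term : samplable sample_term.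
Proof.
by apply: samplable_for_each => t; split=> //; apply: norm1_gate_neq0.
Qed.

Lemma surely_sample_gate t : surely (sample_gate E t) valid_gate.
Proof.
move=> v /=; split; last exact: term_gaussian.
rewrite normf_div normr_id; have [->|c0] := eqVneq (coef v) 0.
  by rewrite normr0 mul0r ler01.
by rewrite divff // normr_eq0.
Qed.

Lemma surely_sample_term : surely sample_term valid_term.
Proof.
have := surely_for_each (enum 'I_T.+1) surely_sample_gate.
by apply: surely_impl => w; rewrite size_enum_ord.
Qed.

Lemma surely_sparsify k :
  surely (sparsify E k)
    (fun d => size d = k /\ forall w, w \in d -> valid_term w).
Proof.
have := surely_for_each (iota 0 k) (fun=> surely_sample_term).
apply: surely_impl => d; rewrite size_iota => -[sd vd]; split=> // w.
by move=> /(nthP [::]) [j jd <-]; apply: vd; rewrite -sd.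
Qed.

(** A gate costs 3: the draw, the recording of its phase and unitary, and the list extension. Each
    term adds one more step to its [T + 1] gates. *)
Lemma runtime_sparsify k : (runtime (sparsify E k) <= k * (T.+1 * 3).+1)%N.
Proof.
rewrite -{2}(size_iota 0 k); apply: runtime_for_each => _.
apply: leq_trans (runtime_for_each _ (b := 2) _) _; last first.
  by rewrite size_enum_ord.
by move=> t /=; rewrite ltnS; apply/bigmax_leqP.
Qed.

Lemma sampled_gateE w t : valid_term w -> (t < T.+1)%N ->
  exists z V, [/\ `|z| <= 1, gaussian_unitary V & sampled_gate w t = z *: V].
Proof.
move=> [_ vw] tT; have [z1 gV] := vw t (0, 0) tT.
by exists (nth (0, 0) w t).1, (nth (0, 0) w t).2; split=> //;
  rewrite /sampled_gate; case: nth.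
Qed.

(** Being a multiple of a Gaussian state is preserved by every sampled gate and by every free Kraus
    operator. *)
Lemma term_operator_gaussian w m phi : valid_term w -> gaussian_state phi ->
  exists s g, gaussian_state g /\ term_operator E w m *m phi = s *: g.
Proof.
move=> vw gphi.
pose Q (S : 'M[C]_(2 ^ n)) :=
  exists s g, gaussian_state g /\ S *m phi = s *: g.
have Qgate S t : (t < T.+1)%N -> Q S -> Q (sampled_gate w t *m S).
  move=> /(sampled_gateE vw) [z [V [_ gV ->]]] [s [g [gg SE]]].
  exists (z * s), (V *m g); split; first exact: gaussian_unitary_state.
  by rewrite -mulmxA SE -scalemxAl -scalemxAr scalerA.
apply: (@foldl_ind _ _ _ Q).
  move=> S t [s [g [gg SE]]]; rewrite -mulmxA; apply: Qgate.
    by rewrite ltnS.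
  have [s' [g' [_ gg' KE]]] := kraus_free E t (m t) gg.
  by exists (s * s'), g'; split=> //; rewrite -mulmxA SE -scalemxAr KE scalerA.
rewrite -[sampled_gate w 0]mulmx1; apply: Qgate => //.
by exists 1, phi; rewrite mul1mx scale1r.
Qed.

Lemma omega_ket_superposition k d m phi :
  size d = k -> (forall w, w \in d -> valid_term w) -> gaussian_state phi ->
  gaussian_superposition k (omega_ket E phi d m).
Proof.
move=> sd vd gphi.
have /fin_all_exists [s] : forall i : 'I_k, exists s g, gaussian_state g /\
    term_operator E (nth [::] d i) m *m phi = s *: g.
  move=> i; apply: term_operator_gaussian => //; apply: vd.
  by rewrite mem_nth // sd.
move=> /fin_all_exists [g sgE].
exists (fun i => coef_norm1 E / (size d)%:R * s i), g.
split; first by move=> i; have [] := sgE i.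
rewrite /omega_ket /sparse_operator -scalemxAl (big_nth [::]) big_mkord.
rewrite sd mulmx_suml scaler_sumr; apply: eq_bigr => i _.
by have [_ ->] := sgE i; rewrite scalerA.
Qed.

Lemma omegaE phi d : omega E phi d = \sum_m ketbra (omega_ket E phi d m).
Proof. by apply: eq_bigr => m _; rewrite adjoint_action_ketbra. Qed.

Lemma mxtrace_sampled_gate w t rho : valid_term w -> (t < T.+1)%N ->
  0 <= \tr rho <= 1 -> 0 <= \tr (adjoint_action (sampled_gate w t) rho) <= 1.
Proof.
move=> vw tT /andP [r0 r1]; have [z [V [z1 [Vu _] ->]]] := sampled_gateE vw tT.
rewrite /adjoint_action adjmxZ -!scalemxAl -scalemxAr scalerA mxtraceZ.
rewrite mxtrace_unitary_conj // -normCK.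
have z2 : `|z| ^+ 2 <= 1 by rewrite exprn_ile1.
by rewrite mulr_ge0 ?exprn_ge0 //= mulr_ile1 ?exprn_ge0.
Qed.

(** By the Kraus expansion the sum is the output trace of a circuit with the sampled gates. These do
    not increase the trace, and the channels between them preserve it. It provides the sure bound on
    the squared norm of one sample. *)
Lemma mxtrace_terms_le1 w phi : valid_term w -> gaussian_state phi ->
  \sum_m \tr (ketbra (term_operator E w m *m phi)) <= 1.
Proof.
move=> vw gphi; rewrite -raddf_sum /=.
under eq_bigr => m _ do rewrite -adjoint_action_ketbra.
rewrite (kraus_expansion (fun t : 'I_T => sampled_gate w t.+1)).
set sigma := foldl _ _ _.
suff /andP [] : 0 <= \tr sigma <= 1 by [].
apply: (foldl_ind (Q := fun rho : 'M_(2 ^ n) => 0 <= \tr rho <= 1)).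
  move=> rho t rhoP; apply: mxtrace_sampled_gate => //; first by rewrite ltnS.
  by rewrite kraus_trace_preserving.
by apply: mxtrace_sampled_gate; rewrite ?gaussian_state_trace1 // ler01 lexx.
Qed.

Definition gate_operator (m : {ffun 'I_T -> bool}) : 'M[C]_(2 ^ n) :=
  foldl (fun S (t : 'I_T) => gate E (lift ord0 t) *m kraus E t (m t) *m S)
        (gate E ord0) (enum 'I_T).

Lemma circuit_channel_ketbra phi :
  circuit_channel E (ketbra phi) = \sum_m ketbra (gate_operator m *m phi).
Proof.
under eq_bigr => m _ do rewrite -adjoint_action_ketbra.
by rewrite (kraus_expansion (fun t : 'I_T => gate E (lift ord0 t))).
Qed.

Lemma mxtrace_circuit_channel phi : gaussian_state phi ->
  \tr (circuit_channel E (ketbra phi)) = 1.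
Proof.
move=> gphi; apply: (foldl_ind (Q := fun rho : 'M_(2 ^ n) => \tr rho = 1)).
  move=> rho t rho1; rewrite mxtrace_unitary_conj ?gate_unitary //.
  by rewrite kraus_trace_preserving.
by rewrite mxtrace_unitary_conj ?gate_unitary // gaussian_state_trace1.
Qed.

(** Probability times phase is [(|a|/N)(a/|a|) = a/N], also for [a = 0]. *)
Lemma expectation_sample_gate t :
  expectation (sample_gate E t) (fun g => g.1 *: g.2) = (N t)^-1 *: gate E t.
Proof.
rewrite expectation_Sample gate_decomposition scaler_sumr.
apply: eq_bigr => v _; rewrite [expectation _ _]expectation_Ret !scalerA /=.
congr (_ *: _); have [->|c0] := eqVneq (coef v) 0.
  by rewrite normr0 !mul0r !mulr0.
rewrite mulrAC mulrCA divff ?mulr1 ?normr_eq0 // mulrC //.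
Qed.

(** Brings the lookup by position into the zipped form of [expectation_foldl], with the initial gate
    kept apart. *)
Lemma term_operator_zip g0 w m : size w = T ->
  term_operator E (g0 :: w) m =
  foldl (fun S tg => (tg.2.1 *: tg.2.2) *m kraus E tg.1 (m tg.1) *m S)
    (g0.1 *: g0.2) (zip (enum 'I_T) w).
Proof.
move=> sw; rewrite (zip_enum_ord (0, 0)) //.
rewrite foldl_map /term_operator.
have gE (g : outcome) : (let: (z, V) := g in z *: V) = g.1 *: g.2 by case: g.
by rewrite /sampled_gate /= gE; apply: eq_foldl => S t; rewrite gE.
Qed.

Lemma expectation_term_operator m :
  expectation sample_term (fun w => term_operator E w m) =
  (coef_norm1 E)^-1 *: gate_operator m.
Proof.
rewrite enum_ordSl for_each_cons expectation_bind for_each_map.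
set body := sample_gate E \o lift ord0.
(* Each later gate is grouped with the Kraus operator before it, and [F] is the product of the means
   of these factors. *)
pose g (t : 'I_T) (x : outcome) := (x.1 *: x.2) *m kraus E t (m t).
pose F := foldl (fun (S : 'M[C]_(2 ^ n)) t => expectation (body t) (g t) *m S)
  1%:M (enum 'I_T).
transitivity (expectation (sample_gate E ord0) (fun x => F *m (x.1 *: x.2))).
  apply: eq_expectation => x; rewrite expectation_bind.
  rewrite /F -foldl_mulmx -expectation_foldl; apply: eq_expectation_surely.
  have := surely_for_each (enum 'I_T)
    (fun t => @surely_sample_gate (lift ord0 t)).
  apply: surely_impl => w; rewrite size_enum_ord => -[sw _].
  by rewrite [LHS]expectation_Ret term_operator_zip.
rewrite expectation_mulmxl expectation_sample_gate /F -foldl_mulmx.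
pose U (t : 'I_T) := gate E (lift ord0 t) *m kraus E t (m t).
have stepE : (fun (S : 'M[C]_(2 ^ n)) t => expectation (body t) (g t) *m S) =2
    (fun S t => ((N (lift ord0 t))^-1 *: U t) *m S).
  move=> S t; rewrite /g expectation_mulmxr expectation_sample_gate.
  by rewrite scalemxAl.
rewrite (eq_foldl stepE) foldl_scale_mulmx; congr (_ *: _).
by rewrite coef_norm1E big_ord_recl prodfV invfM big_enum.
Qed.

Lemma trace_norm_sparsify k phi : gaussian_state phi -> (0 < k)%N ->
  trace_norm (expectation (sparsify E k) (fun d => normalized (omega E phi d))
              - circuit_channel E (ketbra phi))
  <= 2 * (coef_norm1 E ^+ 2 / k%:R)
     + sqrtC (variance (sparsify E k) (fun d => \tr (omega E phi d))).
Proof.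
move=> gphi k0.
(* The factor [coef_norm1 E] makes a single sample unbiased: its mean is the exact branch
   [gate_operator m *m phi]. *)
pose X m w := coef_norm1 E *: (term_operator E w m *m phi).
have EX m : expectation sample_term (X m) = gate_operator m *m phi.
  rewrite /X expectationZ expectation_mulmxr expectation_term_operator.
  by rewrite -scalemxAl scalerA divff ?scale1r // coef_norm1_neq0.
have chanE : circuit_channel E (ketbra phi) =
    \sum_m expectation sample_term (X m) *m (expectation sample_term (X m))^t*.
  rewrite circuit_channel_ketbra; apply: eq_bigr => m _.
  by rewrite EX.
have X2 : surely sample_term
    (fun w => \sum_m \tr (X m w *m (X m w)^t*) <= coef_norm1 E ^+ 2).
  apply: surely_impl surely_sample_term => w vw.
  apply: le_trans (_ : coef_norm1 E ^+ 2 *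
    \sum_m \tr (ketbra (term_operator E w m *m phi)) <= _); last first.
    by rewrite ler_piMr ?exprn_ge0 ?coef_norm1_ge0 // mxtrace_terms_le1.
  rewrite mulr_sumr; apply: ler_sum => m _.
  rewrite /X adjmxZ -scalemxAl -scalemxAr scalerA mxtraceZ.
  by rewrite geC0_conj ?coef_norm1_ge0.
have sk : (0 < size (iota 0 k))%N by rewrite size_iota.
have tr1 := mxtrace_circuit_channel gphi; rewrite chanE in tr1.
(* [omega] divides by [size d], the abstract estimate by the fixed [k]; they agree on all
   descriptions that can be returned. *)
pose Om d : 'M[C]_(2 ^ n) := \sum_m (k%:R^-1 *: \sum_(w <- d) X m w)
  *m (k%:R^-1 *: \sum_(w <- d) X m w)^t*.
have omE : surely (sparsify E k) (fun d => omega E phi d = Om d).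
  apply: surely_impl (surely_sparsify k) => d [sd _].
  rewrite omegaE; apply: eq_bigr => m _.
  suff -> : k%:R^-1 *: \sum_(w <- d) X m w = omega_ket E phi d m by [].
  rewrite /omega_ket /sparse_operator -scalemxAl sd mulmx_suml !scaler_sumr.
  by apply: eq_bigr => w _; rewrite scalerA mulrC.
have expE : expectation (sparsify E k) (fun d => normalized (omega E phi d)) =
    expectation (sparsify E k) (fun d => normalized (Om d)).
  by apply: eq_expectation_surely; apply: surely_impl omE => d ->.
have varE : variance (sparsify E k) (fun d => \tr (omega E phi d)) =
    variance (sparsify E k) (fun d => \tr (Om d)).
  by apply: eq_variance_surely; apply: surely_impl omE => d ->.
have := trace_norm_error samplable_term sk tr1 X2.
rewrite -chanE size_iota -/(sparsify E k) expE varE.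
exact.
Qed.

End CircuitSparsification.

Theorem lemma1 (R : realType) :
  exists c0 : nat,
  forall (n T k : nat) (E : circuit R n T) (phi0 : 'cV[R[i]]_(2 ^ n)),
  gaussian_state phi0 -> (0 < k)%N ->
  let P := sparsify E k in
  let Omega := omega E phi0 in
  let rho1 := expectation P (fun d => normalized (Omega d)) in
  [/\ (0 < T)%N -> (runtime P <= c0 * (k * T))%N,
      forall d, d \in results P ->
        [/\ size d = k,
            forall w, w \in d -> size w = T.+1 /\
              (forall g, g \in w -> gaussian_unitary g.2),
            Omega d = \sum_m ketbra (omega_ket E phi0 d m)
          & forall m, gaussian_superposition k (omega_ket E phi0 d m)],
      rho1 = \sum_(O <- undup (map Omega (results P)))
               prob P (fun d => Omega d == O) *: normalized O
    & trace_norm (rho1 - circuit_channel E (ketbra phi0))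
        <= 2 * (coef_norm1 E ^+ 2 / k%:R)
           + sqrtC (variance P (fun d => \tr (Omega d)))].
Proof.
(* The runtime is at most [k (3T + 4)], and [3T + 4 <= 7T] once [T >= 1]. *)
exists 7%N => n T k E phi0 gphi k0 P Omega rho1; split.
- by move=> T0; apply: leq_trans (runtime_sparsify E k) _; nia.
- move=> d dP; have [sd vd] := surely_results (surely_sparsify E k) dP.
  split=> //; last first.
  + by move=> m; apply: omega_ket_superposition.
  + exact: omegaE.
  move=> w /vd [sw vw]; split=> // g /(nthP (0, 0)) [j jw <-].
  by have [] := vw j (0, 0); rewrite -?sw.
(* Different descriptions may give the same operator, so outcomes are grouped by the value of
   [Omega]. *)
- rewrite /rho1 /expectation (partition_big_undup _ (Omega \o snd)).
  rewrite /results -map_comp; apply: eq_bigr => O _.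
  rewrite /prob scaler_suml; apply: eq_bigr => o /eqP oO.
  by rewrite -oO.
- exact: trace_norm_sparsify.
Qed.
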